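(* The only powers of $3$ that can be written as the sum of twenty-two or fewer distinct powers of $2$ are $3^x$ with $0\le x\le 25$. That is, for an integer $x\ge 0$, there exist an integer $n$ with $1\le n\le 22$ and integers $0\le a_1<\cdots<a_n$ such that $$3^x = 2^{a_1}+\cdots+2^{a_n}$$ if and only if $x\le 25$.
   Context: A power of $2$ (respectively, of $3$) means an integer $2^a$ (respectively, $3^a$) with $a\ge 0$ an integer; in particular $1$ is a power of $2$ and a power of $3$. *)

(* Defs.v *)
From mathcomp Require Import all_boot.

(* Main.v *)
(* Write pop N for the number of ones of N in base 2. Reducing N modulo 2^L - 1, or modulo 2^k (2^L - 1), does not increase pop N. For suitable L the order of 3 modulo 2^L - 1 is small and smooth, and sieving the exponents X with pop (3^X) <= 22 by a few such moduli leaves only X = x modulo 923076000 with 7 <= x <= 25.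

The congruence is then lifted. Suppose 3^X = 3^x modulo 2^L - 1 and modulo 2^k, and cut the bits of 3^X above position k into blocks modulo 2^(2 L) - 1, giving A + 2^L B. Then A + B equals the corresponding part v of 3^x, since a carry out of the top block would cost too many ones (after a shift). If moreover 3^X = 3^x modulo some m dividing 2^L + 1, then m divides 2 B; as no positive multiple B <= v of m gives v = (v - B) + B with few enough ones, B = 0 and the congruence holds modulo 2^(2 L) - 1. Conversely, the order of 3 modulo a divisor of 2^(2 L) - 1 divides X - x, which yields new admissible m and k. Continuing until 2^39 divides X - x, one gets 3^X = 3^x + 2^41 H with H a positive multiple of 2^75 - 1, so pop H >= 75, a contradiction. *)

From Stdlib Require Import ZArith Lia.
From Stdlib Require List.
Require Import Defs.
From mathcomp Require Import all_boot.

Local Open Scope Z_scope.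
Local Arguments Z.add : simpl never.
Local Arguments Z.mul : simpl never.
Local Arguments Z.sub : simpl never.
Local Arguments Z.pow : simpl never.

(** * Counting the ones in base 2 *)

Fixpoint popp (p : positive) : Z :=
  match p with
  | xH => 1
  | xO p => popp p
  | xI p => 1 + popp p
  end.

Definition pop (z : Z) : Z := if z is Zpos p then popp p else 0.

Lemma popp_gt0 p : 0 < popp p.
Proof. elim: p => [p IH|p IH|] /=; lia. Qed.

Lemma pop_ge0 z : 0 <= pop z.
Proof. case: z => [|p|p] //=; have := popp_gt0 p; lia. Qed.

Lemma popp_succ p : popp (Pos.succ p) <= popp p + 1.
Proof. elim: p => [p IH|p IH|] /=; lia. Qed.

Lemma popp_add p q :
  popp (p + q) <= popp p + popp q /\
  popp (Pos.add_carry p q) <= popp p + popp q + 1.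
Proof.
elim: p q => [p IH|p IH|] [q|q|] /=; try have [] := IH q;
  try have := popp_succ p; try have := popp_succ q;
  try have := popp_gt0 p; try have := popp_gt0 q; lia.
Qed.

Lemma pop_add a b : 0 <= a -> 0 <= b -> pop (a + b) <= pop a + pop b.
Proof.
case: a => [|p|p] //; case: b => [|q|q] // _ _; try by rewrite /=; lia.
by have [] := popp_add p q.
Qed.

Lemma pop_double a : pop (2 * a) = pop a.
Proof. by case: a. Qed.

Lemma pop_double1 a : 0 <= a -> pop (2 * a + 1) = 1 + pop a.
Proof. by case: a => [|p|p] // []. Qed.

Lemma pop_split k lo hi : 0 <= k -> 0 <= lo < 2 ^ k -> 0 <= hi ->
  pop (lo + 2 ^ k * hi) = pop lo + pop hi.
Proof.
move=> k0; move: k k0 lo hi; apply: natlike_ind => [|k k0 IH] lo hi lo_lt hi0.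
  have -> : lo = 0 by rewrite /= in lo_lt; lia.
  by rewrite Z.mul_1_l.
rewrite Z.pow_succ_r // in lo_lt *.
have [b [q [-> b01 q_lt]]] : exists b q, [/\ lo = 2 * q + b, 0 <= b <= 1 & 0 <= q < 2 ^ k].
  exists (lo mod 2), (lo / 2); have := Z.div_mod lo 2; have := Z.mod_pos_bound lo 2.
  by split; lia.
have q0 : 0 <= q + 2 ^ k * hi by lia.
have -> : 2 * q + b + 2 * 2 ^ k * hi = 2 * (q + 2 ^ k * hi) + b by lia.
have [->|->] : b = 0 \/ b = 1 by lia.
- by rewrite !Z.add_0_r !pop_double IH.
- by rewrite !pop_double1 ?IH; lia.
Qed.

Lemma pop_shift k a : 0 <= k -> 0 <= a -> pop (a * 2 ^ k) = pop a.
Proof.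
move=> k0 a0; have k2 : 0 < 2 ^ k by apply: Z.pow_pos_nonneg.
have := pop_split k 0 a k0; rewrite Z.add_0_l Z.mul_comm => -> //.
Qed.

Lemma pop_ones k : 0 <= k -> pop (2 ^ k - 1) = k.
Proof.
move: k; apply: natlike_ind => // k k0 IH; rewrite Z.pow_succ_r //.
have k2 : 0 < 2 ^ k by apply: Z.pow_pos_nonneg.
have -> : 2 * 2 ^ k - 1 = 2 * (2 ^ k - 1) + 1 by lia.
by rewrite pop_double1 ?IH; lia.
Qed.

(* Reducing modulo 2^L - 1 amounts to adding the part above bit [L] to the part below, and addition does not create ones. *)
Lemma pop_fold L H r : 0 < L -> 0 < H -> 0 <= r <= 2 ^ L - 1 ->
  (2 ^ L - 1 | H - r) -> pop r <= pop H.
Proof.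
move=> L0 H0 rL; have L2 : 2 <= 2 ^ L.
  by have := Z.pow_le_mono_r 2 1 L; lia.
move: H0 => /[dup] /Z.lt_le_incl; move: H; apply: Zlt_0_ind => H IH _ H0 [c Hc].
have [H_lt|H_ge] := Z.lt_ge_cases H (2 ^ L).
  (* As H > 0, a nonzero [c] forces H = 2^L - 1 and r = 0. *)
  have [r0|->] : r = 0 \/ H = r.
    have : c <= -1 \/ c = 0 \/ 1 <= c by lia.
    by case=> [?|[?|?]]; nia.
    by rewrite r0; apply: pop_ge0.
  lia.
have e := Z.div_mod H (2 ^ L); have lo := Z.mod_pos_bound H (2 ^ L).
have q0 : 0 < H / 2 ^ L by apply: Z.div_str_pos; lia.
set q := H / 2 ^ L in e q0 *; set t := H mod 2 ^ L in e lo *.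
have eH : H = t + 2 ^ L * q by lia.
have -> : pop H = pop t + pop q by rewrite eH pop_split; lia.
apply: Z.le_trans (pop_add _ _ _ _); try lia.
apply: IH; [nia|lia|]; exists (c - q); nia.
Qed.

(** [pop_fold] is applied to the representative 2^L - 1 of the class of 0, which has [L] ones. *)
Lemma pop_multiple L H : 0 < L -> 0 < H -> (2 ^ L - 1 | H) -> L <= pop H.
Proof.
move=> L0 H0 [c Hc]; rewrite -{1}(pop_ones L); last lia.
have L2 : 2 <= 2 ^ L by have := Z.pow_le_mono_r 2 1 L; lia.
apply: (pop_fold L) => //; first lia.
by exists (c - 1); lia.
Qed.

(** * Congruences and powers modulo m *)

Lemma odd_gauss m a b : Z.odd m -> 0 <= a -> (m | b * 2 ^ a) -> (m | b).
Proof.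
move=> /Z.odd_spec [t mE]; move: a; apply: natlike_ind => [|a a0 IH].
  by rewrite Z.mul_1_r.
rewrite Z.pow_succ_r // => -[q Hq]; apply: IH.
(* As m = 2 t + 1, b 2^a = m b 2^a - t (2 b 2^a). *)
exists (b * 2 ^ a - t * q).
have -> : (b * 2 ^ a - t * q) * m = b * 2 ^ a * m - t * (q * m) by ring.
by rewrite -Hq mE; ring.
Qed.

Lemma divide_refl_sub m a : (m | a - a).
Proof. by rewrite Z.sub_diag; apply: Z.divide_0_r. Qed.

Lemma divide_sub_trans m a b c : (m | a - b) -> (m | b - c) -> (m | a - c).
Proof. by move=> [p Hp] [q Hq]; exists (p + q); lia. Qed.

Lemma divide_sub_sym m a b : (m | a - b) -> (m | b - a).
Proof. by move=> [p Hp]; exists (- p); lia. Qed.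

Lemma divide_sub_mul m a b c d :
  (m | a - b) -> (m | c - d) -> (m | a * c - b * d).
Proof.
move=> [p Hp] [q Hq]; exists (p * c + b * q).
have -> : a * c - b * d = (a - b) * c + b * (c - d) by ring.
by rewrite Hp Hq; ring.
Qed.

Lemma divide_sub_pow m a b n : 0 <= n -> (m | a - b) -> (m | a ^ n - b ^ n).
Proof.
move=> n0 mab; move: n n0; apply: natlike_ind => [|n n0 IH].
  exact: divide_refl_sub.
by rewrite !Z.pow_succ_r //; apply: divide_sub_mul.
Qed.

Lemma divide_pow_sub1 m b n c : 0 <= n -> 0 <= c ->
  (m | b ^ n - 1) -> (m | b ^ (n * c) - 1).
Proof.
move=> n0 c0 h; rewrite Z.pow_mul_r //.
by have := divide_sub_pow _ _ _ _ c0 h; rewrite Z.pow_1_l.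
Qed.

(** The preperiod [e] takes the place of invertibility of [g] modulo [m]: 3 divides 2^L - 1 for even
    L. *)
Lemma pow_periodic m g e T a b : 0 <= e <= a -> e <= b -> 0 < T ->
  (m | g ^ (T + e) - g ^ e) -> (T | a - b) -> (m | g ^ a - g ^ b).
Proof.
move=> ea eb T0 h; wlog ab : a b ea eb / b <= a => [hw Tab|[c Hc]].
  have [ab|ab] := Z.le_ge_cases b a; first by apply: hw => //.
  by apply/divide_sub_sym/hw; [lia|lia|lia|exact: divide_sub_sym].
have c0 : 0 <= c by nia.
have -> : a = c * T + b by lia.
have -> : b = (b - e) + e by lia.
set n := b - e; have n0 : 0 <= n by rewrite /n; lia.
move: c c0 {Hc}; apply: natlike_ind => [|c c0 IH].
  exact: divide_refl_sub.
apply: divide_sub_trans IH.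
have -> : g ^ (Z.succ c * T + (n + e)) = g ^ (c * T + n) * g ^ (T + e).
  by rewrite -Z.pow_add_r; [congr (_ ^ _); ring|nia|lia].
have -> : g ^ (c * T + (n + e)) = g ^ (c * T + n) * g ^ e.
  by rewrite -Z.pow_add_r; [congr (_ ^ _); ring|nia|lia].
by apply: divide_sub_mul => //; exact: divide_refl_sub.
Qed.

Fixpoint powm (b m : Z) (e : positive) : Z :=
  match e with
  | xH => b mod m
  | xO e => let r := powm b m e in (r * r) mod m
  | xI e => let r := powm b m e in (b * ((r * r) mod m)) mod m
  end.

Definition powmod (b e m : Z) : Z := if e is Zpos p then powm b m p else 1.

Lemma powmod_spec b e m : 0 < m -> 0 <= e -> (m | powmod b e m - b ^ e).
Proof.
move=> m0; have modl z : (m | z mod m - z).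
  by exists (- (z / m)); have := Z.div_mod z m; lia.
case: e => [|p|p] // _; first exact: divide_refl_sub.
elim: p => [p IH|p IH|]; rewrite /powmod /=.
- rewrite Pos2Z.inj_xI Z.pow_add_r // Z.pow_1_r Z.mul_comm.
  rewrite (Z.mul_comm 2) Z.pow_mul_r // Z.pow_2_r Z.mul_comm.
  apply: divide_sub_trans (modl _) _.
  apply: divide_sub_trans _ (_ : (m | b * (powmod b (Zpos p) m * powmod b (Zpos p) m) - _)).
    by apply: divide_sub_mul (modl _); exact: divide_refl_sub.
  rewrite (Z.mul_comm (_ * _) b).
  by apply: divide_sub_mul; [exact: divide_refl_sub|exact: divide_sub_mul].
- rewrite Pos2Z.inj_xO (Z.mul_comm 2) Z.pow_mul_r // Z.pow_2_r.
  by apply: divide_sub_trans (modl _) _; exact: divide_sub_mul.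
- by rewrite Z.pow_1_r.
Qed.

Lemma powmod_eq b e m c : 0 < m -> 0 <= e -> powmod b e m = c -> (m | b ^ e - c).
Proof. by move=> m0 e0 <-; exact/divide_sub_sym/powmod_spec. Qed.

(** * Reduction modulo 2^k (2^L - 1) by shifts *)

(* A pair [(k, L)] stands for the modulus 2^k (2^L - 1). *)
Definition modulus (s : Z * Z) := 2 ^ s.1 * (2 ^ s.2 - 1).

Definition valid (s : Z * Z) := (0 <=? s.1) && (0 <? s.2).

Definition fold (L h : Z) := Z.land h (Z.ones L) + Z.shiftr h L.

(** When k < L, two folds bring a product of two reduced residues back to about k + L bits, without
    division. *)
Definition red (s : Z * Z) (a : Z) :=
  Z.land a (Z.ones s.1) + Z.shiftl (fold s.2 (fold s.2 (Z.shiftr a s.1))) s.1.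

(* The second alternative holds when [r] is not fully reduced, so that no size bound on [red] has to be proved. *)
Definition admissible (s : Z * Z) (r : Z) :=
  (pop r <=? 22) || (Z.ones s.2 <? Z.shiftr r s.1).

Lemma fold_spec L h : 0 < L -> 0 <= h ->
  0 <= fold L h /\ (2 ^ L - 1 | fold L h - h).
Proof.
move=> L0 h0; rewrite /fold Z.land_ones ?Z.shiftr_div_pow2; try lia.
have L2 : 0 < 2 ^ L by apply: Z.pow_pos_nonneg; lia.
have := Z.div_mod h (2 ^ L); have := Z.mod_pos_bound h (2 ^ L).
have := Z.div_pos h (2 ^ L); split; first lia.
by exists (- (h / 2 ^ L)); lia.
Qed.

Lemma red_spec s a : valid s -> 0 <= a ->
  0 <= red s a /\ (modulus s | red s a - a).
Proof.
case: s => k L /andP[/Z.leb_le /= k0 /Z.ltb_lt /= L0] a0.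
rewrite /red /modulus /= Z.land_ones ?Z.shiftl_mul_pow2 ?Z.shiftr_div_pow2 //.
have k2 : 0 < 2 ^ k by apply: Z.pow_pos_nonneg; lia.
have q0 : 0 <= a / 2 ^ k by apply: Z.div_pos.
have [f0 f1] := fold_spec L _ L0 q0.
have [g0 g1] := fold_spec L _ L0 f0.
have [c Hc] := divide_sub_trans _ _ _ _ g1 f1.
have := Z.div_mod a (2 ^ k); have := Z.mod_pos_bound a (2 ^ k).
split; first nia.
by exists c; nia.
Qed.

(** The low k bits of [r] and [N] agree, and [pop_fold] compares the parts above them; 2^k <= N
    makes that part of [N] positive, as [pop_fold] requires. *)
Lemma admissible_spec s N r : valid s -> 2 ^ s.1 <= N -> pop N <= 22 ->
  0 <= r -> (modulus s | r - N) -> admissible s r.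
Proof.
case: s => k L /andP[/Z.leb_le /= k0 /Z.ltb_lt /= L0] Nk N22 r0 [c Hc].
rewrite /modulus /= in Hc.
apply/orP; rewrite /= Z.shiftr_div_pow2 //.
have [_|hL] := Z.ltb_spec (Z.ones L) (r / 2 ^ k); first by right.
left; apply/Z.leb_le; rewrite Z.ones_equiv in hL.
have k2 : 0 < 2 ^ k by apply: Z.pow_pos_nonneg; lia.
have k2n : 2 ^ k <> 0 by lia.
have rE := Z.div_mod r (2 ^ k) k2n; have rB := Z.mod_pos_bound r (2 ^ k).
have NE := Z.div_mod N (2 ^ k) k2n; have NB := Z.mod_pos_bound N (2 ^ k).
have NH : 0 < N / 2 ^ k by apply: Z.div_str_pos; lia.
have rH : 0 <= r / 2 ^ k by apply: Z.div_pos.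
have lo : r mod 2 ^ k = N mod 2 ^ k.
  have -> : r = N + c * (2 ^ L - 1) * 2 ^ k by lia.
  exact: Z_mod_plus_full.
have hi : r / 2 ^ k - N / 2 ^ k = c * (2 ^ L - 1).
  by apply: (Z.mul_reg_l _ _ (2 ^ k)); lia.
have popE z : 0 <= z -> pop z = pop (z mod 2 ^ k) + pop (z / 2 ^ k).
  move=> z0; rewrite {1}(Z.div_mod z (2 ^ k)) // Z.add_comm pop_split //.
    by apply: Z.mod_pos_bound; lia.
  exact: Z.div_pos.
have h : pop (r / 2 ^ k) <= pop (N / 2 ^ k).
  by apply: (pop_fold L) => //; apply: divide_sub_sym; exists c.
by have := popE r r0; have := popE N; rewrite lo; lia.
Qed.

Fixpoint pow3 (s : Z * Z) (e : positive) : Z :=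
  match e with
  | xH => 3
  | xO e => let r := pow3 s e in red s (r * r)
  | xI e => let r := pow3 s e in red s (3 * red s (r * r))
  end.

Lemma pow3_spec s e : valid s ->
  0 <= pow3 s e /\ (modulus s | pow3 s e - 3 ^ Zpos e).
Proof.
move=> sv; elim: e => [e [e0 IH]|e [e0 IH]|] /=; last by split=> //; exact: divide_refl_sub.
- have [|a0 a1] := red_spec s (pow3 s e * pow3 s e) sv; first nia.
  have [|b0 b1] := red_spec s (3 * red s (pow3 s e * pow3 s e)) sv; first nia.
  split=> //; apply: divide_sub_trans b1 _.
  rewrite (Pos2Z.inj_xI e) (Z.add_comm _ 1) Z.pow_add_r // Z.pow_1_r.
  apply: divide_sub_mul; first exact: divide_refl_sub.
  rewrite (Z.mul_comm 2) Z.pow_mul_r // Z.pow_2_r.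
  by apply: divide_sub_trans a1 _; exact: divide_sub_mul.
- have [|a0 a1] := red_spec s (pow3 s e * pow3 s e) sv; first nia.
  split=> //; apply: divide_sub_trans a1 _.
  rewrite (Pos2Z.inj_xO e) (Z.mul_comm 2) Z.pow_mul_r // Z.pow_2_r.
  exact: divide_sub_mul.
Qed.

Local Arguments pow3 : simpl never.

(** * Sieving exponents by residue classes *)

Fixpoint residues (ss : seq (Z * Z)) (rs : seq Z) (e : Z) : Prop :=
  match ss, rs with
  | s :: ss, r :: rs =>
      [/\ 0 <= r, (modulus s | r - 3 ^ e) & residues ss rs e]
  | [::], [::] => True
  | _, _ => False
  end.

Fixpoint mulred (ss : seq (Z * Z)) (rs gs : seq Z) : seq Z :=
  match ss, rs, gs with
  | s :: ss, r :: rs, g :: gs => red s (r * g) :: mulred ss rs gs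
  | _, _, _ => [::]
  end.

Lemma mulred_spec ss rs gs a b : all valid ss -> 0 <= a -> 0 <= b ->
  residues ss rs a -> residues ss gs b -> residues ss (mulred ss rs gs) (a + b).
Proof.
move=> + a0 b0; elim: ss rs gs => [|s ss IH] [|r rs] [|g gs] //=.
move=> /andP[sv ssv] [r0 ra rsa] [g0 gb gsb].
have [|t0 t1] := red_spec s (r * g) sv; first nia.
split=> //; last exact: IH.
by apply: divide_sub_trans t1 _; rewrite Z.pow_add_r //; exact: divide_sub_mul.
Qed.

(* Tests the products modulo the first [n] moduli; once these are passed, the moduli are dropped. *)
Fixpoint sift (n : nat) (ss : seq (Z * Z)) (rs gs : seq Z) : option (seq Z) :=
  match n, ss, rs, gs with
  | n.+1, s :: ss, r :: rs, g :: gs =>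
      if admissible s (red s (r * g)) then sift n ss rs gs else None
  | _, _, _, _ => Some (mulred ss rs gs)
  end.

(** Equality of the two representatives certifies the period [T] from exponent 26 on. The bound 41
    is the largest k with 2^k <= 3^26. *)
Definition periodic (n : nat) (T : positive) (ss : seq (Z * Z)) :=
  all (fun s => (s.1 <=? 41) && (pow3 s (T + 26) =? pow3 s 26)) (take n ss).

Lemma periodic_spec s T X x : valid s -> pow3 s (T + 26) = pow3 s 26 ->
  26 <= X -> 26 <= x -> (Zpos T | x - X) -> (modulus s | 3 ^ x - 3 ^ X).
Proof.
move=> sv e hX hx TxX; apply: (pow_periodic _ _ 26 (Zpos T)) => //.
have [_ h1] := pow3_spec s (T + 26) sv; have [_ h2] := pow3_spec s 26 sv.
apply: divide_sub_trans (divide_sub_sym _ _ _ h1) _.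
by rewrite e.
Qed.

Lemma pow2_le_pow3 k X : k <= 41 -> 26 <= X -> 2 ^ k <= 3 ^ X.
Proof.
move=> hk hX; have h1 : 2 ^ k <= 2 ^ 41 by apply: Z.pow_le_mono_r; lia.
have h2 : 3 ^ 26 <= 3 ^ X by apply: Z.pow_le_mono_r; lia.
by apply: Z.le_trans h1 (Z.le_trans _ _ _ _ h2); apply/Z.leb_le; vm_compute.
Qed.

(** [T] is a period of 3 modulo each of the first [n] moduli, so testing 3^(a + b) there amounts to
    testing 3^X, which passes. *)
Lemma sift_spec n T ss rs gs a b X : all valid ss -> periodic n T ss ->
  0 <= a -> 0 <= b -> 26 <= a + b -> residues ss rs a -> residues ss gs b ->
  26 <= X -> pop (3 ^ X) <= 22 -> (Zpos T | a + b - X) ->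
  exists2 ts, sift n ss rs gs = Some ts & residues (drop n ss) ts (a + b).
Proof.
move=> + + a0 b0 hab + + hX X22 TX.
elim: n ss rs gs => [|n IH] ss rs gs ssv per ra gb.
  by exists (mulred ss rs gs); rewrite ?drop0 //; exact: mulred_spec.
case: ss rs gs ssv per ra gb => [|s ss] [|r rs] [|g gs] //= ssv per ra gb.
  by exists [::].
case/andP: ssv => sv ssv; case: ra => r0 ra rsa; case: gb => g0 gb gsb.
move: per; rewrite /periodic /= => /andP[/andP[/Z.leb_le k41 /Z.eqb_eq e] per].
have [|t0 t1] := red_spec s (r * g) sv; first nia.
have -> : admissible s (red s (r * g)).
  apply: (admissible_spec _ (3 ^ X)) => //.
    exact: pow2_le_pow3.
  apply: divide_sub_trans t1 _; apply: divide_sub_trans _ (periodic_spec _ _ _ _ sv e hX hab TX).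
  by rewrite Z.pow_add_r //; exact: divide_sub_mul.
exact: IH.
Qed.

(** Multiplication by these entries splits any class modulo [T] into its [q] subclasses; one table
    serves all classes. *)
Fixpoint table (q : nat) (T off : Z) (ss : seq (Z * Z)) (gs cur : seq Z) :
    seq (Z * seq Z) :=
  if q is q.+1 then
    (off, cur) :: table q T (off + T) ss gs (mulred ss cur gs)
  else [::].

Lemma table_spec q T off ss gs cur i : all valid ss -> 0 <= T -> 0 <= off ->
  residues ss cur off -> residues ss gs T -> 0 <= i < Z.of_nat q ->
  exists2 rs, List.In (off + T * i, rs) (table q T off ss gs cur)
            & residues ss rs (off + T * i).
Proof.
move=> ssv T0; elim: q off cur i => [|q IH] off cur i off0 hcur hgs hi; first lia.
have [->|i0] : i = 0 \/ 0 < i by lia.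
  by rewrite Z.mul_0_r Z.add_0_r; exists cur => //; left.
have [|||rs h1 h2] := IH (off + T) (mulred ss cur gs) (i - 1) _ _ hgs; try lia.
  exact: mulred_spec.
have <- : off + T + T * (i - 1) = off + T * i by ring.
by exists rs => //; right.
Qed.

Definition step (n q : nat) (T : positive) (ss : seq (Z * Z))
    (cls : seq (Z * seq Z)) : seq (Z * seq Z) :=
  let gs := [seq pow3 s T | s <- ss] in
  let tab := table q (Zpos T) 0 ss gs [seq 1 | _ <- ss] in
  flatten [seq pmap (fun t => omap (pair (c.1 + t.1)) (sift n ss c.2 t.2)) tab
          | c <- cls].

Lemma In_pmap A B (f : A -> option B) s a b :
  List.In a s -> f a = Some b -> List.In b (pmap f s).
Proof.
move=> + fa; elim: s => //= x s IH [->|/IH h]; first by rewrite fa; left.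
by case: (f x) => //= y; right.
Qed.

Lemma In_flatten_map A B (f : A -> seq B) s a b :
  List.In a s -> List.In b (f a) -> List.In b (flatten [seq f x | x <- s]).
Proof.
move=> + bfa; elim: s => //= x s IH [->|/IH h]; apply: List.in_or_app;
  by [left|right].
Qed.

(* The least common multiple of the orders of 3 modulo the parts prime to 3 of 2^50 - 1, 2^60 - 1 and 2^75 - 1. *)
Definition period : Z := 923076000.

(** The range starts at 7 because 3^6 < 2^10 < 3^7: if 3^X = 3^x modulo 2^10 (2^L - 1) with X > x
    and 3^x < 2^10, then the part of 3^X above bit 10 is a positive multiple of 2^L - 1 and has at
    least L ones. *)
Definition near_small (X : Z) := exists2 x, 7 <= x <= 25 & (period | X - x).

(* A class [(x, rs)] stands for the exponents congruent to [x] modulo [T], with [rs] the residues of 3^x modulo the moduli still to be tested. *)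
Definition covers (T : positive) (ss : seq (Z * Z)) (cls : seq (Z * seq Z)) :=
  forall X, 26 <= X -> pop (3 ^ X) <= 22 -> near_small X \/
    exists x rs, [/\ List.In (x, rs) cls, 26 <= x, (Zpos T | X - x) & residues ss rs x].

Lemma residues_pow3 ss e : all valid ss -> residues ss [seq pow3 s e | s <- ss] (Zpos e).
Proof.
by elim: ss => //= s ss IH /andP[sv ssv]; have [] := pow3_spec s e sv; split=> //; exact: IH.
Qed.

Lemma residues_1 ss : residues ss [seq 1 | _ <- ss] 0.
Proof. by elim: ss => //= s ss IH; split=> //; exact: divide_refl_sub. Qed.

Lemma step_spec n q T T' ss cls : all valid ss ->
  Zpos T' = Zpos T * Z.of_nat q -> periodic n T' ss ->
  covers T ss cls -> covers T' (drop n ss) (step n q T ss cls).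
Proof.
move=> ssv T'E per hcls X hX X22.
have [|[x [rs [xrs x26 [c Hc] hrs]]]] := hcls X hX X22; [by left|right].
have q0 : 0 < Z.of_nat q by lia.
have cE := Z.div_mod c (Z.of_nat q); have cB := Z.mod_pos_bound c _ q0.
(* The quotient [c] modulo [q] selects the subclass of [X]. *)
set i := c mod Z.of_nat q in cE cB.
have [gs] := table_spec q (Zpos T) 0 ss [seq pow3 s T | s <- ss] [seq 1 | _ <- ss] i
  ssv (Pos2Z.is_nonneg T) (Z.le_refl 0) (residues_1 ss) (residues_pow3 ss T ssv) cB.
rewrite Z.add_0_l => gs_in hgs.
have Ti : 0 <= Zpos T * i by lia.
have [|||ts tsE hts] := sift_spec n T' ss rs gs x (Zpos T * i) X ssv per _ Ti _ hrs hgs hX X22.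
- lia.
- lia.
- by exists (- (c / Z.of_nat q)); rewrite T'E; nia.
exists (x + Zpos T * i), ts; split=> //; last by exists (c / Z.of_nat q); rewrite T'E; nia.
  apply: (In_flatten_map _ _ _ _ (x, rs)) => //.
  by apply: (In_pmap _ _ _ _ (Zpos T * i, gs)) => //=; rewrite tsE.
lia.
Qed.

Definition small_class (x : Z) := (7 <=? x mod period) && (x mod period <=? 25).

(** As 3^x has at most 22 ones for x <= 25, these classes cannot be expected to fall to further
    sieving; they are left to the lifting. *)
Lemma drop_small_classes T ss cls : (period | Zpos T) ->
  covers T ss cls -> covers T ss [seq c <- cls | ~~ small_class c.1].
Proof.
move=> pT hcls X hX X22.
have [|[x [rs [xrs x26 Tx hrs]]]] := hcls X hX X22; [by left|].
have [/andP[/Z.leb_le a /Z.leb_le b]|small] := boolP (small_class x).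
  left; exists (x mod period) => //.
  apply: divide_sub_trans (Z.divide_trans _ _ _ pT Tx) _.
  by exists (x / period); have := Z.div_mod x period; rewrite /period; lia.
right; exists x, rs; split=> //.
elim: cls xrs {hcls} => //= c cls IH [cE|/IH h]; first by rewrite cE small; left.
by case: ifP => // _; right.
Qed.

(* The first moduli have small orders of 3, and each later one enlarges the accumulated period by a small factor only. *)
Definition moduli : seq (Z * Z) :=
  [:: (5, 60); (10, 60); (10, 48); (10, 45); (10, 75); (10, 50); (10, 100)].

Definition surviving_classes : seq (Z * seq Z) :=
  let cls := [:: (26, [seq pow3 s 26 | s <- moduli])] in
  (* Nothing is tested here: 6600 = 75 * 88 is reached in two steps to keep the tables short. *)
  let cls := step 0 75 1 moduli cls in
  let cls := step 1 88 75 moduli cls in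
  let cls := step 1 32 6600 (drop 1 moduli) cls in
  let cls := step 1 7 211200 (drop 2 moduli) cls in
  let cls := step 2 111 1478400 (drop 3 moduli) cls in
  let cls := step 1 45 164102400 (drop 5 moduli) cls in
  let cls := [seq c <- cls | ~~ small_class c.1] in
  step 1 179 7384608000 (drop 6 moduli) cls.

Lemma surviving_classes_nil : surviving_classes = [::].
Proof. by vm_cast_no_check (erefl ([::] : seq (Z * seq Z))). Qed.

Lemma near_small_of_pop X : 26 <= X -> pop (3 ^ X) <= 22 -> near_small X.
Proof.
move=> hX X22.
have: covers 1321844832000 (drop 7 moduli) surviving_classes.
  apply: (step_spec 1 179 7384608000); [by []|by []|by vm_compute|].
  apply: drop_small_classes; first by exists 8.
  apply: (step_spec 1 45 164102400); [by []|by []|by vm_compute|].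
  apply: (step_spec 2 111 1478400); [by []|by []|by vm_compute|].
  apply: (step_spec 1 7 211200); [by []|by []|by vm_compute|].
  apply: (step_spec 1 32 6600); [by []|by []|by vm_compute|].
  apply: (step_spec 1 88 75); [by []|by []|by vm_compute|].
  apply: (step_spec 0 75 1); [by []|by []|by []|].
  move=> Y _ _; right; exists 26, [seq pow3 s 26 | s <- moduli].
  by split; [left|lia|exact: Z.divide_1_l|exact: residues_pow3].
rewrite surviving_classes_nil => /(_ X hX X22)[//|].
by move=> [x [rs []]].
Qed.

(** * Lifting congruences from 2^L - 1 to 2^(2 L) - 1 and 2^(3 L) - 1 *)

(* If a sum of at most three [L]-bit blocks is congruent to [v] without being equal to it, then a carry has left the top block and re-entered as [- 1] or [- 2] at the bottom of [v], which costs too many ones. *)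
Lemma block_sum L S v w : 50 <= L -> 2 <= v < 2 ^ 49 ->
  w < 1 + pop (v - 1) -> w < 1 + pop (v - 2) ->
  0 <= S <= 3 * (2 ^ L - 1) -> (2 ^ L - 1 | S - v) -> pop S <= w -> S = v.
Proof.
move=> L50 v50 w1 w2 S3 [c Hc] Sw.
have P50 : 2 ^ 50 <= 2 ^ L by apply: Z.pow_le_mono_r.
have : c <= -1 \/ c = 0 \/ c = 1 \/ c = 2 \/ 3 <= c by lia.
case=> [?|[?|[c1|[c2|?]]]]; [nia|nia| | |nia].
- have SE : S = (v - 1) + 2 ^ L * 1 by rewrite c1 in Hc; lia.
  by move: Sw; rewrite SE pop_split //=; lia.
- have SE : S = (v - 2) + 2 ^ L * 2 by rewrite c2 in Hc; lia.
  by move: Sw; rewrite SE pop_split //=; lia.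
Qed.

(** [G] and [v] stand for the parts of 3^X and 3^x above bit k, up to a common shift, and [w] for
    the number of ones that [G] may have. *)
Lemma double_lift L G v m w : 50 <= L -> 0 < G -> pop G <= w ->
  2 <= v < 2 ^ 49 -> w < 1 + pop (v - 1) -> w < 1 + pop (v - 2) ->
  Z.odd m -> (m | 2 ^ L + 1) -> (m | G - v) ->
  (forall B, 0 < B <= v -> (m | B) -> w < pop B + pop (v - B)) ->
  (2 ^ L - 1 | G - v) -> (2 ^ (2 * L) - 1 | G - v).
Proof.
move=> L50 G0 Gw v50 w1 w2 m_odd mP mG noB LG.
have P50 : 2 ^ 50 <= 2 ^ L by apply: Z.pow_le_mono_r.
have PP : 2 ^ (2 * L) = 2 ^ L * 2 ^ L by rewrite -Z.pow_add_r; [congr (_ ^ _)| |]; lia.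
set P := 2 ^ L in P50 PP *.
have rM : (2 ^ (2 * L) - 1 | G - G mod (2 ^ (2 * L) - 1)).
  by exists (G / (2 ^ (2 * L) - 1)); have := Z.div_mod G (2 ^ (2 * L) - 1); nia.
have rB : 0 <= G mod (2 ^ (2 * L) - 1) < 2 ^ (2 * L) - 1 by apply: Z.mod_pos_bound; nia.
move: (G mod _) rM rB => r rM rB.
have rw : pop r <= w by apply: Z.le_trans (pop_fold (2 * L) G r _ G0 _ rM) Gw; lia.
have [A [B [rE AP BP]]] : exists A B, [/\ r = A + P * B, 0 <= A < P & 0 <= B < P].
  exists (r mod P), (r / P); have := Z.div_mod r P; have := Z.mod_pos_bound r P.
  by split; [lia|lia|split; [apply: Z.div_pos|apply: Z.div_lt_upper_bound]; lia].
have rpop : pop r = pop A + pop B by rewrite rE pop_split; lia.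
have [q Hq] := rM.
have SE : A + B = v.
  apply: (block_sum L _ _ w) => //; [by rewrite -/P; lia| |].
    apply: divide_sub_trans _ LG; exists (- (q * (P + 1)) - B).
    rewrite -/P; rewrite PP rE in Hq.
    have -> : A + B - G = - (G - (A + P * B)) - (P - 1) * B by ring.
    by rewrite Hq; ring.
  by apply: Z.le_trans (pop_add _ _ _ _) _; lia.
(* Modulo [m], P = -1, so v = A + P B = A - B; with v = A + B this makes [m] divide 2 B. *)
have mB : (m | B).
  apply: (odd_gauss m 1) => //; rewrite Z.pow_1_r.
  have [a Ha] := mP; have [b Hb] := mG.
  exists (a * B - b + q * (P - 1) * a); rewrite PP rE in Hq.
  have -> : B * 2 = (P + 1) * B - (G - v) + (G - (A + P * B)) by lia.
  have PPE : P * P - 1 = (P + 1) * (P - 1) by ring.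
  by rewrite Hq Hb PPE Ha; ring.
have [B0|B0] : B = 0 \/ 0 < B by lia.
  by have <- : r = v by lia.
have := noB B _ mB; have -> : v - B = A by lia.
by lia.
Qed.

(** The three blocks satisfy A + B + C = v, and [m] divides 3 (B^2 + B C + C^2), which is at most 3
    v^2 < m; hence B = C = 0, with no search over splittings of [v]. *)
Lemma triple_lift L G v m w : 50 <= L -> 0 < G -> pop G <= w ->
  2 <= v < 2 ^ 49 -> w < 1 + pop (v - 1) -> w < 1 + pop (v - 2) ->
  (m | 2 ^ L * 2 ^ L + 2 ^ L + 1) -> (m | G - v) -> 3 * (v * v) < m ->
  (2 ^ L - 1 | G - v) -> (2 ^ (3 * L) - 1 | G - v).
Proof.
move=> L50 G0 Gw v50 w1 w2 mP mG v_lt LG.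
have P50 : 2 ^ 50 <= 2 ^ L by apply: Z.pow_le_mono_r.
have PP : 2 ^ (3 * L) = 2 ^ L * (2 ^ L * 2 ^ L).
  by rewrite -!Z.pow_add_r; [congr (_ ^ _)| | | |]; lia.
set P := 2 ^ L in P50 PP mP *.
have rM : (2 ^ (3 * L) - 1 | G - G mod (2 ^ (3 * L) - 1)).
  by exists (G / (2 ^ (3 * L) - 1)); have := Z.div_mod G (2 ^ (3 * L) - 1); nia.
have rB : 0 <= G mod (2 ^ (3 * L) - 1) < 2 ^ (3 * L) - 1 by apply: Z.mod_pos_bound; nia.
move: (G mod _) rM rB => r rM rB.
have rw : pop r <= w by apply: Z.le_trans (pop_fold (3 * L) G r _ G0 _ rM) Gw; lia.
have [A [D [rE AP DP]]] : exists A D, [/\ r = A + P * D, 0 <= A < P & 0 <= D < P * P].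
  exists (r mod P), (r / P); have := Z.div_mod r P; have := Z.mod_pos_bound r P.
  by split; [lia|lia|split; [apply: Z.div_pos|apply: Z.div_lt_upper_bound]; lia].
have [B [C [DE BP CP]]] : exists B C, [/\ D = B + P * C, 0 <= B < P & 0 <= C < P].
  exists (D mod P), (D / P); have := Z.div_mod D P; have := Z.mod_pos_bound D P.
  by split; [lia|lia|split; [apply: Z.div_pos|apply: Z.div_lt_upper_bound]; lia].
have rpop : pop r = pop A + (pop B + pop C).
  by rewrite rE pop_split ?DE ?pop_split; lia.
rewrite DE in rE.
have [q Hq] := rM.
have SE : A + (B + C) = v.
  apply: (block_sum L _ _ w) => //; [by rewrite -/P; lia| |].
    apply: divide_sub_trans _ LG; exists (- (q * (P * P + P + 1)) - (B + C * (P + 1))).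
    rewrite -/P; rewrite PP rE in Hq.
    have -> : A + (B + C) - G =
      - (G - (A + P * (B + P * C))) - (P - 1) * (B + C * (P + 1)) by ring.
    by rewrite Hq; ring.
  apply: Z.le_trans (pop_add _ _ _ _) _; try lia.
  by have := pop_add B C; lia.
(* With z = 2^L mod m a primitive cube root of unity, m divides 3 (B - z C)(B - z^2 C), and that product is the norm of B and C. *)
have mBC : (m | 3 * (B * B + B * C + C * C)).
  have [a Ha] := mP; have [b Hb] := mG; rewrite PP rE in Hq.
  have mE : (m | (P - 1) * (B + (P + 1) * C)).
    exists (b - q * (P - 1) * a).
    have -> : (P - 1) * (B + (P + 1) * C) = (G - v) - (G - (A + P * (B + P * C))) by lia.
    have PPE : P * (P * P) - 1 = (P - 1) * (P * P + P + 1) by ring.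
    by rewrite Hq Hb PPE Ha; ring.
  have [e He] := mE.
  (* This combines 3 = (P^2 + P + 1) - (P - 1) (P + 2) with (B + (P + 1) C) (B - P C) = B^2 + B C +
     C^2 - (P^2 + P + 1) C^2. *)
  exists (a * (B + (P + 1) * C) * (B - P * C) - e * (P + 2) * (B - P * C) + 3 * a * (C * C)).
  have -> : 3 * (B * B + B * C + C * C) =
      ((P * P + P + 1) * (B + (P + 1) * C) - (P - 1) * (B + (P + 1) * C) * (P + 2)) * (B - P * C)
      + 3 * (P * P + P + 1) * (C * C) by ring.
  by rewrite Ha He; ring.
have [n Hn] := mBC.
have BB := Z.square_nonneg B; have CC := Z.square_nonneg C.
have BC : 0 <= B * C by apply: Z.mul_nonneg_nonneg; lia.
have vv : (B + C) * (B + C) <= v * v by apply: Z.mul_le_mono_nonneg; lia.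
have n0 : n = 0.
  have : n <= -1 \/ n = 0 \/ 1 <= n by lia.
  by case=> [n1|[//|n1]]; have := Z.mul_le_mono_nonneg_r _ _ m _ n1; lia.
rewrite n0 in Hn.
have /Z.mul_eq_0 B0 : B * B = 0 by lia.
have /Z.mul_eq_0 C0 : C * C = 0 by lia.
have B0' : B = 0 by lia.
have C0' : C = 0 by lia.
rewrite B0' C0' in rE SE.
by have <- : r = v by lia.
Qed.

(** * Passing from 3^X and 3^x to their parts above bit k *)

Lemma pow3_pow2 n : 1 <= n -> (2 ^ (n + 2) | 3 ^ (2 ^ n) - 1).
Proof.
move=> n1; have -> : n = (n - 1) + 1 by lia.
have := Z.le_0_sub 1 n; set i := n - 1 => -[_ /(_ n1)] i0.
move: i i0 {n1}; apply: natlike_ind => [|i i0 [c Hc]]; first by exists 1.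
have e : Z.succ i + 1 = Z.succ (i + 1) by lia.
rewrite e (Z.pow_succ_r 2 (i + 1)) ?(Z.mul_comm 2 (2 ^ (i + 1))) ?Z.pow_mul_r; try lia.
rewrite Z.pow_2_r; set a := 3 ^ 2 ^ (i + 1) in Hc *.
have -> : Z.succ (i + 1) + 2 = Z.succ (i + 1 + 2) by lia.
have e' : 2 ^ (i + 1 + 2) = 2 * 2 ^ (i + 2).
  by rewrite -Z.pow_succ_r; [congr (_ ^ _)|]; lia.
rewrite Z.pow_succ_r; last lia.
(* Squaring [a] gains a factor 2, since a + 1 is even. *)
exists (c * (c * 2 ^ (i + 2) + 1)).
have -> : a * a - 1 = (a - 1) * ((a - 1) + 2) by ring.
by rewrite Hc e'; ring.
Qed.

Lemma pow3_close k X x : 3 <= k -> 0 <= X -> 0 <= x ->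
  (2 ^ (k - 2) | X - x) -> (2 ^ k | 3 ^ X - 3 ^ x).
Proof.
move=> k3 X0 x0; have T0 : 0 < 2 ^ (k - 2) by apply: Z.pow_pos_nonneg; lia.
apply: (pow_periodic _ _ 0); [lia|lia|lia|].
by rewrite Z.add_0_r; have := pow3_pow2 (k - 2); rewrite Z.sub_add; apply; lia.
Qed.

Lemma odd_mersenne L : 0 < L -> Z.odd (2 ^ L - 1).
Proof.
move=> L0; have -> : L = 1 + (L - 1) by lia.
by rewrite Z.pow_add_r; [rewrite Z.odd_sub Z.odd_mul|lia|lia].
Qed.

(* Shifting [v] to the left far enough makes the low bits of [v - 1] and [v - 2] all ones, as [block_sum] requires. *)
Fixpoint widen (fuel : nat) (w v : Z) : Z :=
  if fuel is fuel.+1 then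
    if (w <? 1 + pop (v - 1)) && (w <? 1 + pop (v - 2)) then v
    else widen fuel w (v * 2)
  else v.

Lemma widen_spec fuel w v : exists2 j, 0 <= j & widen fuel w v = v * 2 ^ j.
Proof.
elim: fuel v => [|fuel IH] v /=; first by exists 0 => //; rewrite Z.mul_1_r.
case: ifP => _; first by exists 0 => //; rewrite Z.mul_1_r.
have [j j0 ->] := IH (v * 2); exists (j + 1); first lia.
by rewrite Z.add_1_r Z.pow_succ_r //; ring.
Qed.

(** The case u = 0 is accepted outright: the part of 3^X above bit k is then a positive multiple of
    2^L - 1, with too many ones. The conditions on [v] are rechecked, so the fuel 30 need not be
    justified. *)
Definition window_ok (k : Z) (test : Z -> Z -> bool) (x : Z) :=
  let u := 3 ^ x / 2 ^ k in
  if u =? 0 then true else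
  let w := 22 - pop (3 ^ x mod 2 ^ k) in
  let v := widen 30 w u in
  [&& 2 <=? v, v <? 2 ^ 49, w <? 1 + pop (v - 1), w <? 1 + pop (v - 2) & test w v].

(** Removing the common low k bits and then shifting left by j changes neither divisibility of the
    difference by an odd number nor the ones of the upper part of 3^X. *)
Lemma window_lift X x k L M test :
  26 <= X -> 0 <= x -> pop (3 ^ X) <= 22 -> 0 <= k <= 41 ->
  (2 ^ k | 3 ^ X - 3 ^ x) -> 50 <= L -> (2 ^ L - 1 | 3 ^ X - 3 ^ x) ->
  window_ok k test x ->
  (forall G v w, 0 < G -> pop G <= w -> 2 <= v < 2 ^ 49 ->
    w < 1 + pop (v - 1) -> w < 1 + pop (v - 2) -> test w v ->
    (forall m, Z.odd m -> (m | 3 ^ X - 3 ^ x) -> (m | G - v)) -> (M | G - v)) ->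
  Z.odd M -> (M | 3 ^ X - 3 ^ x).
Proof.
rewrite /window_ok => hX x0 X22 k41 kN L50 LN wk lift M_odd.
have k2 : 0 < 2 ^ k by apply: Z.pow_pos_nonneg; lia.
have k3 : 2 ^ k <= 3 ^ X by apply: pow2_le_pow3; lia.
have N0 : 0 < 3 ^ X by lia.
have n0 : 0 < 3 ^ x by apply: Z.pow_pos_nonneg; lia.
move: (3 ^ X) (3 ^ x) X22 kN LN lift k3 N0 n0 wk => N n N22 [c Hc] LN lift k3 N0 n0.
have k2n : 2 ^ k <> 0 by lia.
have lo : N mod 2 ^ k = n mod 2 ^ k.
  have -> : N = n + c * 2 ^ k by lia.
  exact: Z_mod_plus_full.
have NE := Z.div_mod N (2 ^ k) k2n; have NB := Z.mod_pos_bound N (2 ^ k) k2.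
have nE := Z.div_mod n (2 ^ k) k2n; have nB := Z.mod_pos_bound n (2 ^ k) k2.
have H0 : 0 < N / 2 ^ k by apply: Z.div_str_pos; lia.
have u0 : 0 <= n / 2 ^ k by apply: Z.div_pos; lia.
have Npop : pop N = pop (n mod 2 ^ k) + pop (N / 2 ^ k).
  by rewrite {1}NE lo Z.add_comm pop_split //; lia.
rewrite lo in NE; move: (n mod 2 ^ k) NE nE nB Npop => s NE nE nB Npop.
have NnE : N - n = (N / 2 ^ k - n / 2 ^ k) * 2 ^ k by lia.
move: (N / 2 ^ k) (n / 2 ^ k) H0 u0 Npop NnE {NE nE} => H u H0 u0 Npop NnE.
have odd_div m : Z.odd m -> (m | N - n) -> (m | H - u).
  by move=> m_odd; rewrite NnE; apply: odd_gauss => //; lia.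
rewrite NnE.
case: Z.eqb_spec => [uz _|_].
  have h : L <= pop H.
    apply: pop_multiple; [lia|lia|].
    have := odd_div (2 ^ L - 1); rewrite uz Z.sub_0_r; apply=> //.
    by apply: odd_mersenne; lia.
  by have := pop_ge0 s; lia.
have [j j0 ->] := widen_spec 30 (22 - pop s) u.
move=> /and5P[/Z.leb_le v2 /Z.ltb_lt v49 /Z.ltb_lt w1 /Z.ltb_lt w2 t].
apply: Z.divide_mul_l; apply: (odd_gauss _ j) => //.
have j2 : 0 < 2 ^ j by apply: Z.pow_pos_nonneg; lia.
rewrite Z.mul_sub_distr_r; apply: lift w1 w2 t _; [nia| |lia|].
  by rewrite pop_shift; lia.
by move=> m m_odd mN; rewrite -Z.mul_sub_distr_r; apply/Z.divide_mul_l/odd_div.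
Qed.

(** * Enlarging the known divisor of X - x *)

(** The order of 3 modulo [p] divides T f q^n but not T f q^(n - 1), so it contains the full power
    of the prime [q] in T f q^n. It divides X - x, which therefore gains q^n over [T]. *)
Lemma extend_period p q n f T X x : 0 < p -> 1 < q -> 1 <= n -> 0 < f -> 0 < T ->
  (forall a, 0 < a < q -> Z.gcd a q = 1) ->
  (p | 3 ^ (T * f * q ^ n) - 1) -> ~ (p | 3 ^ (T * f * q ^ (n - 1)) - 1) ->
  0 <= x < X -> (p | 3 ^ X - 3 ^ x) -> (T | X - x) -> (T * q ^ n | X - x).
Proof.
move=> p0 q1 n1 f0 T0 q_prime hq hn1 xX pX TX.
have qn : q ^ n = q ^ (n - 1) * q.
  by rewrite Z.mul_comm -Z.pow_succ_r; [congr (_ ^ _)|]; lia.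
have qn0 : 0 < q ^ (n - 1) by apply: Z.pow_pos_nonneg; lia.
set E := T * f * q ^ (n - 1) in hn1 *.
have hqE : (p | 3 ^ (E * q) - 1).
  have -> : E * q = T * f * q ^ n by rewrite qn /E; ring.
  exact: hq.
have E0 : 0 < E by rewrite /E; nia.
have pd : (p | 3 ^ (X - x) - 1).
  have hEx := divide_pow_sub1 p 3 (E * q) x ltac:(nia) ltac:(lia) hqE.
  (* 3^(E q x - x) serves as an inverse of 3^x modulo [p]. *)
  have h : (p | 3 ^ (E * q * x - x) * 3 ^ X - 3 ^ (E * q * x - x) * 3 ^ x).
    by apply: divide_sub_mul => //; exact: divide_refl_sub.
  rewrite -!Z.pow_add_r in h; try nia.
  have e1 : E * q * x - x + X = E * q * x + (X - x) by ring.
  rewrite e1 Z.sub_add Z.pow_add_r in h; try nia.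
  have h' : (p | 3 ^ (E * q * x) * 3 ^ (X - x) - 1 * 3 ^ (X - x)).
    by apply: divide_sub_mul => //; exact: divide_refl_sub.
  rewrite Z.mul_1_l in h'.
  exact: divide_sub_trans (divide_sub_sym _ _ _ h') (divide_sub_trans _ _ _ _ h hEx).
have: forall i, 0 <= i -> i <= n -> (T * q ^ i | X - x); last by apply; lia.
apply: natlike_ind => [_|i i0 IH iN]; first by rewrite Z.mul_1_r.
have [e He] := IH ltac:(lia).
have Tq0 : 0 < T * q ^ i by apply: Z.mul_pos_pos => //; apply: Z.pow_pos_nonneg; lia.
have e0 : 0 < e by nia.
have he : (p | 3 ^ (E * e) - 1).
  have qi : q ^ (n - 1) = q ^ i * q ^ (n - 1 - i).
    by rewrite -Z.pow_add_r; [congr (_ ^ _)| |]; lia.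
  have y0 : 0 <= f * q ^ (n - 1 - i).
    by apply: Z.mul_nonneg_nonneg; [lia|apply: Z.pow_nonneg; lia].
  have -> : E * e = (X - x) * (f * q ^ (n - 1 - i)) by rewrite He /E qi; ring.
  by apply: divide_pow_sub1 => //; lia.
suff [c Hc] : (q | e).
  by exists c; rewrite Z.pow_succ_r // He Hc; ring.
have eE := Z.div_mod e q; have eB := Z.mod_pos_bound e q.
have [ez|enz] : e mod q = 0 \/ 0 < e mod q by lia.
  by exists (e / q); lia.
have g1 : Z.gcd e q = 1.
  by rewrite Z.gcd_comm -Z.gcd_mod; [apply: q_prime|]; lia.
(* An inverse of [e] modulo [q] turns 3^(E e) = 3^(E q) = 1 into 3^E = 1, against [hn1]; reducing it
   modulo [q] keeps all exponents non-negative. *)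
have [a [b ab]] := Z.gcd_bezout _ _ _ g1.
have aE := Z.div_mod a q; have aB := Z.mod_pos_bound a q.
set a' := a mod q in aE aB; set t := e * (a / q) + b.
have at_ : e * a' = 1 + q * (- t) by rewrite /t; nia.
have t0 : 0 <= - t by nia.
exfalso; apply: hn1.
have h1 : (p | 3 ^ (E * e * a') - 1) by apply: divide_pow_sub1 => //; nia.
have h2 : (p | 3 ^ (E * q * (- t)) - 1) by apply: divide_pow_sub1 => //; nia.
have e2 : E * e * a' = E + E * q * (- t).
  by rewrite -Z.mul_assoc at_; ring.
have Eqt : 0 <= E * q * - t.
  by apply: Z.mul_nonneg_nonneg => //; apply: Z.mul_nonneg_nonneg; lia.
rewrite e2 Z.pow_add_r in h1; [|lia|exact: Eqt].
have h3 : (p | 3 ^ E * 3 ^ (E * q * - t) - 3 ^ E * 1).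
  by apply: divide_sub_mul => //; exact: divide_refl_sub.
rewrite Z.mul_1_r in h3.
exact: divide_sub_trans (divide_sub_sym _ _ _ h3) h1.
Qed.

(** * A checker for chains of lifting rules *)

(* A state [(T, Ls)] records that [T] divides X - x and that 3^X = 3^x modulo 2^L - 1 for [L] in [Ls]. [Double] and [Triple] replace [L] by 2 L and 3 L; their [m] divides 2^L + 1, resp. 4^L + 2^L + 1, and has 3^e = 1 modulo [m] for a divisor [e] of [T], while 2^(k - 2) divides [T]. [Extend] multiplies [T] by q^n, using a divisor [p] of 2^L - 1 such that 3^e = 1 modulo [p]. *)
Inductive rule :=
  | Double (L m e k : Z)
  | Triple (L m e k : Z)
  | Extend (L p q n f e : Z).

(* [v] is not a sum of [B] and [v - B] with at most [w] ones in total, for [B] in an arithmetic progression; running out of fuel counts as failure. *)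
Fixpoint no_split (fuel : nat) (m B w v : Z) :=
  if fuel is fuel.+1 then
    if v <? B then true
    else (w <? pop B + pop (v - B)) && no_split fuel m (B + m) w v
  else false.

Lemma no_splitP fuel m B w v i : 0 <= m -> no_split fuel m B w v ->
  0 <= i -> B + m * i <= v -> w < pop (B + m * i) + pop (v - (B + m * i)).
Proof.
move=> m0; elim: fuel B i => //= fuel IH B i + i0 iv.
case: Z.ltb_spec => [vB|_]; first nia.
move=> /andP[/Z.ltb_lt h1 h2].
have [->|i1] : i = 0 \/ 1 <= i by lia.
  by rewrite Z.mul_0_r Z.add_0_r.
have := IH _ (i - 1) h2; have -> : B + m + m * (i - 1) = B + m * i by ring.
by apply; lia.
Qed.

Local Arguments no_split : simpl never.
Local Arguments powmod : simpl never.

(** All x from 7 to 25 are tested at once, so that a single chain serves them all. *)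
Definition liftable (T : Z) (Ls : seq Z) (L m e k : Z) (test : Z -> Z -> bool) :=
  [&& has (Z.eqb L) Ls, 50 <=? L, 0 <? m, 0 <? e, T mod e =? 0, powmod 3 e m =? 1,
      (3 <=? k) && (k <=? 41), T mod 2 ^ (k - 2) =? 0
    & all (fun i => window_ok k test (Z.of_nat i)) (iota 7 19)].

(** The gcd tests say that [q] is prime. In [Extend], 3^e = 1 modulo [p] allows the huge exponent to
    be reduced modulo [e]. *)
Definition apply_rule (st : Z * seq Z) (rl : rule) : option (Z * seq Z) :=
  let: (T, Ls) := st in
  match rl with
  | Double L m e k =>
      if [&& Z.odd m, powmod 2 L m =? m - 1
           & liftable T Ls L m e k (no_split 500 m m)]
      then Some (T, 2 * L :: Ls) else None
  | Triple L m e k =>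
      let z := powmod 2 L m in
      if [&& Z.odd m, (z * z + z + 1) mod m =? 0
           & liftable T Ls L m e k (fun _ v => 3 * (v * v) <? m)]
      then Some (T, 3 * L :: Ls) else None
  | Extend L p q n f e =>
      if [&& has (Z.eqb L) Ls && (1 <? p), powmod 2 L p =? 1, (1 <? q) && (1 <=? n),
             all (fun a => Z.gcd (Z.of_nat a) q =? 1) (iota 1 (Z.to_nat (q - 1))),
             (0 <? f) && (0 <? e), powmod 3 e p =? 1, (T * f * q ^ n) mod e =? 0
           & ~~ ((powmod 3 ((T * f * q ^ (n - 1)) mod e) p - 1) mod p =? 0)]
      then Some (T * q ^ n, Ls) else None
  end.

Definition known (X x : Z) (st : Z * seq Z) :=
  [/\ 0 < st.1, (st.1 | X - x)
    & forall L, has (Z.eqb L) st.2 -> 0 < L /\ (2 ^ L - 1 | 3 ^ X - 3 ^ x)].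

Lemma liftable_spec X x T Ls L m e k test M :
  26 <= X -> 7 <= x <= 25 -> pop (3 ^ X) <= 22 -> known X x (T, Ls) ->
  liftable T Ls L m e k test -> Z.odd m ->
  (forall G v w, 0 < G -> pop G <= w -> 2 <= v < 2 ^ 49 ->
    w < 1 + pop (v - 1) -> w < 1 + pop (v - 2) -> test w v ->
    50 <= L -> (2 ^ L - 1 | G - v) -> (m | G - v) -> (M | G - v)) ->
  Z.odd M -> (M | 3 ^ X - 3 ^ x).
Proof.
move=> hX hx X22 [/= T0 TX LX].
case/and5P=> Lin /Z.leb_le L50 /Z.ltb_lt m0 /Z.ltb_lt e0 /and5P[/Z.eqb_eq Te /Z.eqb_eq me].
move=> /andP[/Z.leb_le k3 /Z.leb_le k41] /Z.eqb_eq Tk /allP win m_odd lift M_odd.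
have [L0 LN] := LX L Lin.
have eT : (e | T) by apply/Z.mod_divide => //; lia.
have kT : (2 ^ (k - 2) | T) by apply/Z.mod_divide => //; have := Z.pow_pos_nonneg 2 (k - 2); lia.
have mN : (m | 3 ^ X - 3 ^ x).
  apply: (pow_periodic _ _ 0 e); try lia; last exact: Z.divide_trans eT TX.
  by rewrite Z.add_0_r; apply: powmod_eq => //; lia.
apply: (window_lift X x k L M test) => //; try lia.
- by apply: pow3_close; try lia; exact: Z.divide_trans kT TX.
- have -> : x = Z.of_nat (Z.to_nat x) by lia.
  by apply: win; rewrite mem_iota; apply/andP; split; apply/leP; rewrite ?addnE /=; lia.
move=> G v w G0 Gw v49 w1 w2 t odd_div; apply: lift w1 w2 t L50 _ _ => //.
  by apply: odd_div => //; exact: odd_mersenne.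
exact: odd_div.
Qed.

Lemma apply_rule_spec X x st rl st' :
  26 <= X -> 7 <= x <= 25 -> pop (3 ^ X) <= 22 -> known X x st ->
  apply_rule st rl = Some st' -> known X x st'.
Proof.
case: st => T Ls hX hx X22 hk; case: (hk) => /= T0 TX LX.
case: rl => [L m e k|L m e k|L p q n f e] /=; case: ifP => [h [<-]|_ //]; split=> //=.
- move=> L'; case: Z.eqb_spec => [-> _|_ /=]; last exact: LX.
  case/and3P: h => m_odd /Z.eqb_eq mL lif.
  have [L0 m0] : 0 < L /\ 0 < m.
    by case/and4P: lif => _ /Z.leb_le ? /Z.ltb_lt ? _; lia.
  split; first lia.
  apply: (liftable_spec _ _ _ _ _ _ _ _ _ _ hX hx X22 hk lif m_odd); last by apply: odd_mersenne; lia.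
  move=> G v w G0 Gw v49 w1 w2 free L50 LG mG.
  apply: (double_lift L G v m w) => //.
    by have [|c Hc] := powmod_eq 2 L m _ m0 _ mL; [lia|exists (c + 1); lia].
  move=> B Bv [i Hi].
  (* The search starts at [m] itself, so the multiple i m has index i - 1. *)
  have := no_splitP _ _ _ _ _ (i - 1) _ free; have -> : m + m * (i - 1) = B by lia.
  by apply; nia.
- move=> L'; case: Z.eqb_spec => [-> _|_ /=]; last exact: LX.
  case/and3P: h => m_odd /Z.eqb_eq mL lif.
  have [L0 m0] : 0 < L /\ 0 < m.
    by case/and4P: lif => _ /Z.leb_le ? /Z.ltb_lt ? _; lia.
  split; first lia.
  apply: (liftable_spec _ _ _ _ _ _ _ _ _ _ hX hx X22 hk lif m_odd); last by apply: odd_mersenne; lia.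
  move=> G v w G0 Gw v49 w1 w2 /Z.ltb_lt v_lt L50 LG mG.
  apply: (triple_lift L G v m w) => //.
  have h2 := powmod_spec 2 L m m0 ltac:(lia).
  have /Z.mod_divide h3 := mL; have {h3} := h3 ltac:(lia).
  have h4 := divide_sub_mul _ _ _ _ _ h2 h2.
  move: h2 h4 => [a Ha] [b Hb] [c Hc]; exists (c - a - b); lia.
- case/and5P: h => _ _ /andP[/Z.ltb_lt q1 /Z.leb_le n1] _ _.
  by apply: Z.mul_pos_pos => //; apply: Z.pow_pos_nonneg; lia.
case/and5P: h => /andP[Lin /Z.ltb_lt p1] /Z.eqb_eq pL /andP[/Z.ltb_lt q1 /Z.leb_le n1] /allP qP.
case/and4P=> /andP[/Z.ltb_lt f0 /Z.ltb_lt e0] /Z.eqb_eq pe /Z.eqb_eq Te neq.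
have [L0 LN] := LX L Lin.
have p0 : 0 < p by lia.
have period a b : 0 <= a -> 0 <= b -> (e | a - b) -> (p | 3 ^ a - 3 ^ b).
  move=> a0 b0; apply: (pow_periodic _ _ 0 e); try lia.
  by rewrite Z.add_0_r; apply: powmod_eq => //; lia.
have qn0 i : 0 <= i -> 0 < q ^ i by move=> ?; apply: Z.pow_pos_nonneg; lia.
have Tf0 : 0 < T * f by apply: Z.mul_pos_pos.
apply: (extend_period p q n f) => //; try lia.
- move=> a aq; apply/Z.eqb_eq; have -> : a = Z.of_nat (Z.to_nat a) by lia.
  by apply: qP; rewrite mem_iota; apply/andP; split; apply/leP; rewrite ?addnE /=; lia.
- have -> : 1 = 3 ^ 0 by [].
  apply: period => //; first by have := qn0 n; nia.
  by rewrite Z.sub_0_r; apply/Z.mod_divide => //; lia.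
- set E := T * f * q ^ (n - 1) in neq * => hE.
  have E0 : 0 <= E by have := qn0 (n - 1); rewrite /E; nia.
  have Ee := Z.mod_pos_bound E e e0.
  move/negP: neq; apply; apply/Z.eqb_eq/Z.mod_divide; first lia.
  apply: divide_sub_trans _ hE.
  apply: divide_sub_trans (powmod_spec 3 (E mod e) p p0 _) _; first lia.
  apply: period; [lia|lia|].
  by exists (- (E / e)); have := Z.div_mod E e; lia.
- by apply: Z.divide_trans LN; apply: powmod_eq => //; lia.
Qed.

Fixpoint run (st : Z * seq Z) (rls : seq rule) : option (Z * seq Z) :=
  if rls is rl :: rls then
    if apply_rule st rl is Some st then run st rls else None
  else Some st.

Lemma run_spec X x st rls st' :
  26 <= X -> 7 <= x <= 25 -> pop (3 ^ X) <= 22 -> known X x st ->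
  run st rls = Some st' -> known X x st'.
Proof.
move=> hX hx X22; elim: rls st => [|rl rls IH] st hk /=; first by case=> <-.
case e: (apply_rule st rl) => [st1|//]; apply: IH.
exact: apply_rule_spec e.
Qed.

(** * The explicit chain and the bound for X >= 26 *)

(** The exponent of 2 in T grows from 5 to 10, 16, 31, 32, 37 and 39, which lets k grow up to that
    exponent plus 2. The other [Extend] entries supply the primes 71, 17, 19, 13 and 29 that divide
    [e] in later entries. *)
Definition chain : seq rule := [::
    Double 75 3702172441 222750 7;
    Double 150 12852406621 89100 7;
    Extend 300 63901 71 1 1 2130;
    Double 300 32935349441 85200 7;
    Extend 600 4562284561 17 1 1118207 19009519;
    Extend 600 4562284561 19 1 58853 19009519;
    Double 600 178358460673 8400 7;
    Extend 1200 25601 2 5 1 25600;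
    Double 1200 23888344321 69120 12;
    Extend 2400 65537 2 6 1 65536;
    Double 2400 17230721 4480 18;
    Extend 4800 3602561 13 1 433 3602560;
    Extend 4800 18446744069414584321 2 15 16843009 9223372034707292160;
    Triple 60 1258817311 3496500 33;
    Extend 180 29247661 29 1 431 2437305;
    Triple 75 2685450511 14918400 33;
    Double 225 4051 810 33;
    Double 450 54001 13500 33;
    Double 900 433 27 33;
    Double 1800 79201 19800 33;
    Double 3600 414721 13824 33;
    Double 7200 13305601 3326400 33;
    Double 14400 286721 40960 33;
    Double 28800 921601 25600 33;
    Double 57600 3686401 921600 33;
    Double 115200 11059201 345600 33;
    Double 230400 307201 3840 33;
    Double 460800 319489 9984 33;
    Double 921600 737281 36864 33;
    Double 1843200 11304961 7680 33;
    Double 3686400 1769473 55296 33;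
    Double 7372800 117964801 14745600 33;
    Double 14745600 943718401 235929600 33;
    Double 29491200 1811939329 3538944 33;
    Double 58982400 104857601 104857600 33;
    Double 117964800 786432001 16384000 33;
    Double 235929600 45298483201 11324620800 33;
    Double 471859200 8304721921 519045120 33;
    Double 943718400 669410918401 55784243200 33;
    Double 1887436800 264241152001 9437184000 33;
    Double 3774873600 407686348801 33973862400 33;
    Double 7549747200 289910292481 9663676416 33;
    Double 15099494400 140928614401 1006632960 33;
    Double 30198988800 24159191041 12079595520 33;
    Double 60397977600 966367641601 241591910400 33;
    Double 120795955200 912680550401 912680550400 33;
    Extend 241591910400 364750097612801 2 1 3397 364750097612800;
    Double 241591910400 4187593113601 523449139200 34;
    Double 483183820800 3221225472001 107374182400 34;
    Double 966367641600 25409026523137 529354719232 34;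
    Double 1932735283200 4638564679681 4294967296 34;
    Extend 3865470566400 865865406873601 2 5 1 30923764531200;
    Double 3865470566400 30923764531201 618475290624 39;
    Double 7730941132800 4123168604161 687194767360 39;
    Double 15461882265600 2288358575308801 1144179287654400 39;
    Extend 30923764531200 2748779069441 2 2 1 2748779069440].

Definition chain_closes :=
  if run (period, [:: 75; 60]) chain is Some (T, Ls) then
    (T mod 2 ^ 39 =? 0) && has (Z.eqb 75) Ls
  else false.

Lemma chain_closes_true : chain_closes.
Proof. by vm_compute. Qed.

Lemma powmod_close M T X x : 0 < M -> 0 < T -> 7 <= X -> 7 <= x ->
  powmod 3 (T + 7) M = 3 ^ 7 -> (T | X - x) -> (M | 3 ^ X - 3 ^ x).
Proof.
move=> M0 T0 hX hx pM; apply: (pow_periodic _ _ 7); [lia|lia|lia|].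
by apply: powmod_eq; [lia|lia|].
Qed.

Lemma known_start X x : 26 <= X -> 7 <= x <= 25 -> (period | X - x) ->
  known X x (period, [:: 75; 60]).
Proof.
move=> hX hx pX; split=> [|//|L]; first by [].
have h M : 0 < M -> powmod 3 (period + 7) M = 3 ^ 7 -> (M | 3 ^ X - 3 ^ x).
  by move=> M0 pM; apply: powmod_close pM pX; [|by []|lia|lia].
rewrite /=; case: Z.eqb_spec => [->|_] /=.
  by move=> _; split; [|apply: h; vm_compute].
case: Z.eqb_spec => [->|_] // _.
by split; [|apply: h; vm_compute].
Qed.

Lemma pop_pow3_gt22 X : 26 <= X -> 22 < pop (3 ^ X).
Proof.
move=> hX; apply/Z.nle_gt => X22.
have [x hx pX] := near_small_of_pop X hX X22.
have := chain_closes_true; rewrite /chain_closes.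
case e: (run _ _) => [[T Ls]|//] /andP[/Z.eqb_eq T39 L75].
have [/= T0 TX /(_ _ L75) [_ LN]] :=
  run_spec X x _ _ _ hX hx X22 (known_start X x hX hx pX) e.
have [H HE] : (2 ^ 41 | 3 ^ X - 3 ^ x).
  apply: (pow3_close 41); try lia.
  by apply: Z.divide_trans TX; apply/Z.mod_divide.
have x25 : 3 ^ x <= 3 ^ 25 by apply: Z.pow_le_mono_r; lia.
have c25 : 3 ^ 25 < 2 ^ 41 by apply/Z.ltb_lt; vm_compute.
have X26 : 2 ^ 41 <= 3 ^ X by apply: pow2_le_pow3.
have x0 : 0 < 3 ^ x by apply: Z.pow_pos_nonneg; lia.
have H0 : 0 < H by lia.
have H75 : 75 <= pop H.
  apply: (pop_multiple 75); [by []|exact: H0|].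
  by apply: (odd_gauss _ 41); [exact: odd_mersenne|by []|rewrite -HE].
have XE : 3 ^ X = 3 ^ x + 2 ^ 41 * H by lia.
have := pop_ge0 (3 ^ x).
by move: X22; rewrite XE pop_split; lia.
Qed.

(** * Sums of distinct powers of 2 and binary expansions *)

Lemma of_nat_expn b n : Z.of_nat (b ^ n)%N = Z.of_nat b ^ Z.of_nat n.
Proof.
elim: n => [|n IH] //.
by rewrite expnS -multE Nat2Z.inj_mul IH Nat2Z.inj_succ Z.pow_succ_r //; lia.
Qed.

Lemma pop_sum_pow2 n (a : 'I_n -> nat) :
  pop (Z.of_nat (\sum_(i < n) 2 ^ a i)%N) <= Z.of_nat n.
Proof.
elim: n a => [|n IH] a; first by rewrite big_ord0.
rewrite big_ord_recr (Nat2Z.inj_add (\sum_(i < n) _)%N) Nat2Z.inj_succ.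
apply: Z.le_trans (pop_add _ _ (Nat2Z.is_nonneg _) (Nat2Z.is_nonneg _)) _.
have /= IHn := IH (fun i => a (widen_ord (leqnSn n) i)).
have -> : pop (Z.of_nat (2 ^ a ord_max)%N) = 1.
  by rewrite of_nat_expn -[_ ^ _]Z.mul_1_l pop_shift //; lia.
lia.
Qed.

Lemma binary_expansion p : exists s : seq nat,
  [/\ sorted ltn s, Pos.to_nat p = (\sum_(i <- s) 2 ^ i)%N & Z.of_nat (size s) = popp p].
Proof.
have double s : (\sum_(i <- [seq i.+1 | i <- s]) 2 ^ i = 2 * \sum_(i <- s) 2 ^ i)%N.
  by rewrite big_map big_distrr; apply: eq_bigr => i _; rewrite /= expnS.
have shift_sorted s : sorted ltn s -> sorted ltn [seq i.+1 | i <- s].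
  by rewrite sorted_map.
elim: p => [p [s [srt sE sz]]|p [s [srt sE sz]]|].
- exists (0%N :: [seq i.+1 | i <- s]); split.
  + rewrite /= path_min_sorted ?shift_sorted //.
    by apply/allP => _ /mapP[i _ ->].
  + by rewrite Pos2Nat.inj_xI sE big_cons double -multE.
  + by rewrite [size _]/= size_map Nat2Z.inj_succ sz /=; lia.
- exists [seq i.+1 | i <- s]; split; first exact: shift_sorted.
  + by rewrite Pos2Nat.inj_xO sE double -multE.
  + by rewrite size_map.
- by exists [:: 0%N]; rewrite big_seq1.
Qed.

Lemma pop_pow3_le22 : all (fun i => pop (3 ^ Z.of_nat i) <=? 22) (iota 0 26).
Proof. by vm_compute. Qed.

Local Close Scope Z_scope.

Theorem theorem1p1 (x : nat) :
  (exists (n : nat) (a : 'I_n -> nat),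
      [/\ 1 <= n <= 22,
          (forall i j : 'I_n, i < j -> a i < a j) &
          3 ^ x = \sum_(i < n) 2 ^ a i])
  <-> x <= 25.
Proof.
have xZ : Z.of_nat (3 ^ x) = (3 ^ Z.of_nat x)%Z by exact: of_nat_expn.
split=> [[n [a [/andP[_ /leP n22] _ xE]]]|x25].
  rewrite leqNgt; apply/negP => /ltP x26.
  have := pop_sum_pow2 n a; rewrite -xE xZ.
  by have := pop_pow3_gt22 (Z.of_nat x); lia.
have /allP/(_ x) := pop_pow3_le22; rewrite mem_iota => /(_ x25) /Z.leb_le x22.
have : (0 < 3 ^ Z.of_nat x)%Z by apply: Z.pow_pos_nonneg; lia.
case E: (3 ^ Z.of_nat x)%Z xZ => [|p|p] // xZ _.
have [s [srt sE sz]] := binary_expansion p.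
rewrite E /= -sz in x22.
exists (size s), (fun i => nth 0 s i); split.
- apply/andP; split; apply/leP; last lia.
  have := popp_gt0 p; lia.
- move=> i j ij; apply: (sorted_ltn_nth ltn_trans) => //; exact: ltn_ord.
- rewrite -(big_mkord xpredT (fun i => 2 ^ nth 0 s i)) -(big_nth 0 xpredT (fun i => 2 ^ i)).
  by rewrite -sE; lia.
Qed.
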